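(* For every integer $n\ge1$, $$\sum_{\substack{\mathbf w\in \mathrm{PF}_n\\ \mathrm{pk}(\mathbf w)=0\\ \mathrm{tie}(\mathbf w)=0}}t^{\mathrm{des}(\mathbf w)}=\sum_{j=0}^{n-1}\frac1n\binom nj\binom n{j+1}t^j.$$
   Context: A parking function of length $n$ is a word $\mathbf w=(w_1,\dots,w_n)\in[n]^n$, $[n]=\{1,\dots,n\}$, whose nondecreasing rearrangement $b_1\le\dots\le b_n$ satisfies $b_i\le i$ for all $i$; $\mathrm{PF}_n$ is the set of these. For a word $\mathbf w$ of length $n$: $\mathrm{des}(\mathbf w)$ is the number of $i\in[n-1]$ with $w_i>w_{i+1}$; $\mathrm{tie}(\mathbf w)$ is the number of $i\in[n-1]$ with $w_i=w_{i+1}$; $\mathrm{pk}(\mathbf w)$ is the number of indices $2\le i\le n-1$ with $w_{i-1}<w_i>w_{i+1}$. *)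

(* Defs.v *)
From mathcomp Require Import all_boot all_order all_algebra.

Set Implicit Arguments.
Unset Strict Implicit.
Unset Printing Implicit Defensive.

(* Words are sequences w of naturals; positions are counted from 0, so that
   w_(i+1) is nth 0 w i. *)

Definition des (w : seq nat) : nat :=
  count (fun i => nth 0 w i > nth 0 w i.+1) (iota 0 (size w).-1).

Definition tie (w : seq nat) : nat :=
  count (fun i => nth 0 w i == nth 0 w i.+1) (iota 0 (size w).-1).

(* Peaks are interior: the 0-based positions are 1, ..., size w - 2. *)
Definition pk (w : seq nat) : nat :=
  count (fun i => (nth 0 w i.-1 < nth 0 w i) && (nth 0 w i > nth 0 w i.+1))
        (iota 1 (size w).-2).

(* b_i <= i with i counted from 1, for b the nondecreasing rearrangement. *)
Definition parking (w : seq nat) : bool :=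
  all (fun i => nth 0 (sort leq w) i <= i.+1) (iota 0 (size w)).

(* [n] = {1, ..., n} is represented by 'I_n, the ordinal x standing for the
   letter x.+1. *)
Definition word n (w : n.-tuple 'I_n) : seq nat := [seq (val x).+1 | x <- w].

Definition PF n : {set n.-tuple 'I_n} := [set w | parking (word w)].

(* Main.v *)
(* A word with no peak and no tie decreases strictly and then increases
   strictly. A parking function contains the letter 1, which must be the bottom
   of the valley, so the word is D 1 rev(U) with D, U strictly decreasing and
   des = size D. Counting pairs (D, U) with prescribed sizes a, b under the
   parking condition, letter by letter, gives the 2 x 2 determinant
   C(m,a) C(m,b) - C(m,a+1) C(m,b+1), where m = n - 1; for a + b = m it is a
   Narayana number. *)
Require Import Defs.
From mathcomp Require Import all_boot all_order all_algebra.
From mathcomp Require Import zify.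

Set Implicit Arguments.
Unset Strict Implicit.
Unset Printing Implicit Defensive.

Import GRing.Theory.

(** * Pairs of decreasing sequences, counted by sizes *)

(* The pairs (D, U) of strictly decreasing sequences with letters in
   {2, ..., m.+1} whose letters together with 1 satisfy the parking condition
   up to m.+1, generated by deciding which of D and U receive the letter m.+1. *)
Fixpoint pairs (m : nat) : seq (seq nat * seq nat) :=
  if m is m'.+1 then
    let s := pairs m' in
    let l := fun x : seq nat * seq nat => (m.+1 :: x.1, x.2) in
    let r := fun x : seq nat * seq nat => (x.1, m.+1 :: x.2) in
    [seq x <- s ++ map l s ++ map r s ++ map l (map r s)
       | m <= size x.1 + size x.2]
  else [:: ([::], [::])].

Lemma size_pairs m x : x \in pairs m -> m <= size x.1 + size x.2.
Proof. by case: m => [|m] //=; rewrite mem_filter => /andP[]. Qed.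

Definition npairs m a b :=
  count (fun x => (size x.1 == a) && (size x.2 == b)) (pairs m).

Lemma npairs0 m a b : a + b < m -> npairs m a b = 0.
Proof.
move=> lt_m; rewrite /npairs (eq_in_count (a2 := pred0)) ?count_pred0 //.
by move=> x /size_pairs /=; lia.
Qed.

(** The four summands are the four choices of who receives the new letter [m.+2]; as [m < a + b],
    the filter in [pairs] discards nothing of these sizes. *)
Lemma npairsS m a b : m < a + b ->
  npairs m.+1 a b = npairs m a b
    + (if a is a'.+1 then npairs m a' b else 0)
    + (if b is b'.+1 then npairs m a b' else 0)
    + (if a is a'.+1 then if b is b'.+1 then npairs m a' b' else 0 else 0).
Proof.
move=> lt_m; rewrite /npairs /= count_filter.
rewrite (eq_count (a2 := fun x => (size x.1 == a) && (size x.2 == b))); last first.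
  by move=> x /=; lia.
rewrite -/pairs !count_cat !count_map !addnA.
congr (_ + _ + _ + _).
- case: a {lt_m} => [|a]; last exact: eq_count.
  by rewrite (@eq_count _ _ pred0) ?count_pred0.
- case: b {lt_m} => [|b]; last exact: eq_count.
  by rewrite (@eq_count _ _ pred0) ?count_pred0 // => x; rewrite /= andbF.
- case: a {lt_m} => [|a].
    by rewrite (@eq_count _ _ pred0) ?count_pred0.
  case: b => [|b]; last exact: eq_count.
  by rewrite (@eq_count _ _ pred0) ?count_pred0 // => x; rewrite /= andbF.
Qed.

(* The determinant obeys the same Pascal recursion as npairs; including the
   line a + b + 1 = m, where both vanish, makes the recursion valid up to the
   boundary a + b = m. *)
Lemma npairsE m a b : m <= (a + b).+1 ->
  npairs m a b + 'C(m, a.+1) * 'C(m, b.+1) = 'C(m, a) * 'C(m, b).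
Proof.
elim: m a b => [|m IH] a b le_m.
  by rewrite /npairs /= !bin0n; case: a b {le_m} => [|a] [|b].
have [lt_ab|le_ab] := ltnP (a + b) m.+1.
  (* Here [a + b = m], so the symmetry of binomials exchanges the two products. *)
  rewrite npairs0 // -['C(_, a.+1)]bin_sub -1?['C(_, b.+1)]bin_sub; try lia.
  by rewrite mulnC; congr ('C(_, _) * 'C(_, _)); lia.
rewrite npairsS //.
case: a b le_m le_ab => [|a] [|b] le_m le_ab; first by lia.
(* With [a = 0] the bound forces [m <= b], so C(m, b+1) and C(m, b+2) vanish. *)
- have /= := IH 0 b.+1 ltac:(lia); have /= := IH 0 b ltac:(lia).
  rewrite !binS !bin0 (@bin_small m b.+1) ?(@bin_small m b.+2); lia.
- have /= := IH a.+1 0 ltac:(lia); have /= := IH a 0 ltac:(lia).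
  rewrite !binS !bin0 (@bin_small m a.+1) ?(@bin_small m a.+2); lia.
(* Pascal's rule expands each product into four; paired off, they are the determinants of the four
   induction hypotheses. *)
- have /= := IH a.+1 b.+1 ltac:(lia); have /= := IH a b.+1 ltac:(lia).
  have /= := IH a.+1 b ltac:(lia); have /= := IH a b ltac:(lia).
  rewrite !binS; nia.
Qed.

(** * Intrinsic description of the generated pairs *)

(* The letters of s lie in {2, ..., m.+1}. *)
Definition decr m (s : seq nat) := path gtn m.+2 s && all (ltn 1) s.

Lemma decrS m s :
  decr m.+1 s = decr m s || (if s is k :: s' then (k == m.+2) && decr m s' else false).
Proof.
case: s => [|k s] //; rewrite /decr /=.
have [->|ne_k] /= := eqVneq k m.+2.
  by rewrite !ltnn ltnS leqnn.
by rewrite orbF; congr (_ && _ && _); lia.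
Qed.

Lemma decr_le m s : decr m s -> all (geq m.+1) s.
Proof.
by case/andP=> /(order_path_min (rev_trans ltn_trans)).
Qed.

Lemma decr_notin m s : decr m s -> (m.+2 \in s) = false.
Proof. by move/decr_le/allP => le_s; apply/negP => /le_s /=; rewrite ltnn. Qed.

Lemma mem_consl m D U (s : seq (seq nat * seq nat)) :
  ((D, U) \in [seq (m :: x.1, x.2) | x <- s])
  = (if D is k :: D' then (k == m) && ((D', U) \in s) else false).
Proof.
apply/mapP/idP => [[[x1 x2] xs [-> ->]]|]; first by rewrite eqxx.
by case: D => [|k D] // /andP[/eqP-> xs]; exists (D, U).
Qed.

Lemma mem_consr m D U (s : seq (seq nat * seq nat)) :
  ((D, U) \in [seq (x.1, m :: x.2) | x <- s])
  = (if U is k :: U' then (k == m) && ((D, U') \in s) else false).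
Proof.
apply/mapP/idP => [[[x1 x2] xs [-> ->]]|]; first by rewrite eqxx.
by case: U => [|k U] // /andP[/eqP-> xs]; exists (D, U).
Qed.

(** Parking asks for [k.+1] letters at most [k.+1]; one of them is the letter 1, stored in neither
    sequence. *)
Definition balanced m (x : seq nat * seq nat) :=
  all (fun k => k <= count (geq k.+1) x.1 + count (geq k.+1) x.2) (iota 1 m).

Lemma balancedS m x : balanced m.+1 x
  = balanced m x && (m < count (geq m.+2) x.1 + count (geq m.+2) x.2).
Proof. by rewrite /balanced -[m.+1]addn1 iotaD all_cat /= andbT addnC. Qed.

Lemma balanced_consl m D U : balanced m (m.+2 :: D, U) = balanced m (D, U).
Proof.
apply: eq_in_all => k; rewrite mem_iota => le_k /=.
by rewrite (_ : m.+2 <= k.+1 = false) //; lia.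
Qed.

Lemma balanced_consr m D U : balanced m (D, m.+2 :: U) = balanced m (D, U).
Proof.
apply: eq_in_all => k; rewrite mem_iota => le_k /=.
by rewrite (_ : m.+2 <= k.+1 = false) //; lia.
Qed.

Lemma mem_pairs m x :
  (x \in pairs m) = [&& decr m x.1, decr m x.2 & balanced m x].
Proof.
elim: m x => [|m IH] [D U].
  by rewrite inE; case: D U => [|[|[|d]] D] [|[|[|u]] U]; rewrite /decr ?andbF.
(* All letters are at most [m.+2], so the new balance inequality counts every letter and becomes the
   size filter. *)
have -> : [&& decr m.+1 D, decr m.+1 U & balanced m.+1 (D, U)]
    = (m < size D + size U)
      && [&& decr m.+1 D, decr m.+1 U & balanced m (D, U)].
  have [decrD|] /= := boolP (decr m.+1 D); last by rewrite andbF.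
  have [decrU|] /= := boolP (decr m.+1 U); last by rewrite andbF.
  rewrite balancedS andbC /=.
  by have /[!all_count]/eqP-> := decr_le decrD;
    have /[!all_count]/eqP-> := decr_le decrU.
rewrite [pairs _]/= -/pairs mem_filter /= !mem_cat; congr (_ && _).
rewrite !mem_consl mem_consr !decrS !IH /=.
case: D U => [|d D] [|u U]; rewrite ?mem_consr ?IH /= ?orbF //.
- have [->|//] := eqVneq u m.+2; last by rewrite ?orbF.
  by rewrite balanced_consr andb_orl.
- have [->|//] := eqVneq d m.+2; last by rewrite ?orbF.
  by rewrite balanced_consl andb_orl /= orbF.
- have [->|_] := eqVneq d m.+2; have [->|_] := eqVneq u m.+2;
    rewrite ?balanced_consl ?balanced_consr /= ?orbF //;
    case: (decr m (_ :: D)); case: (decr m D);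
    case: (decr m (_ :: U)); case: (decr m U); case: (balanced m _) => //.
Qed.

(** No pair of the previous stage contains the new letter, so the four blocks are told apart by
    which components begin with it. *)
Lemma uniq_pairs m : uniq (pairs m).
Proof.
elim: m => [//|m IH]; apply: filter_uniq; rewrite -/pairs.
have hd x : x \in pairs m -> (m.+2 \in x.1 = false) /\ (m.+2 \in x.2 = false).
  by rewrite mem_pairs => /and3P[/decr_notin-> /decr_notin-> _].
move: (pairs m) IH hd => s IH hd.
have injl : injective (fun x : seq nat * seq nat => (m.+2 :: x.1, x.2)).
  by move=> [x1 x2] [y1 y2] /= [-> ->].
have injr : injective (fun x : seq nat * seq nat => (x.1, m.+2 :: x.2)).
  by move=> [x1 x2] [y1 y2] /= [-> ->].
rewrite !cat_uniq !map_inj_uniq // IH /= andbT.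
rewrite !has_cat !has_map !negb_or.
have notl D U : (m.+2 :: D, U) \notin s.
  by apply/negP => /hd[] /=; rewrite mem_head.
have notr D U : (D, m.+2 :: U) \notin s.
  by apply/negP => /hd[_] /=; rewrite mem_head.
rewrite -!andbA; apply/and5P; split; last (apply/andP; split);
  apply/hasPn => -[[|d D] U] xs //=.
- by rewrite mem_consl.
- rewrite mem_consl; apply/andP => -[/eqP d_eq _].
  by move: xs; rewrite d_eq (negbTE (notl _ _)).
- by rewrite mem_consl eqxx /=.
- by rewrite mem_consl eqxx /=.
- by rewrite mem_consr eqxx /=.
- by rewrite mem_consr eqxx /=.
Qed.

(** * Statistics and shape of valley words *)

Lemma des_cons x y s : des (x :: y :: s) = (x > y) + des (y :: s).
Proof. by rewrite /des /= (iotaDl 1 0) count_map. Qed.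

Lemma tie_cons x y s : tie (x :: y :: s) = (x == y) + tie (y :: s).
Proof. by rewrite /tie /= (iotaDl 1 0) count_map. Qed.

Lemma pk_cons x y z s :
  pk (x :: y :: z :: s) = ((x < y) && (y > z)) + pk (y :: z :: s).
Proof.
rewrite /pk /= (iotaDl 1 1) count_map; congr (_ + _).
by apply: eq_in_count => -[|i]; rewrite mem_iota.
Qed.

Lemma increasing_stats y U : path ltn y U ->
  [/\ des (y :: U) = 0, pk (y :: U) = 0 & tie (y :: U) = 0].
Proof.
elim: U y => [//|z U IH] y /= /andP[lt_yz /[dup] zU /IH[d0 p0 t0]].
rewrite des_cons tie_cons d0 t0; case: U zU p0 {d0 t0 IH} => [|u U].
  by move=> _ _; rewrite /pk /=; split=> //; lia.
by move=> /= /andP[lt_zu _] p0; rewrite pk_cons p0; split; lia.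
Qed.

Lemma valley_stats D y U : sorted gtn (rcons D y) -> path ltn y U ->
  [/\ des (D ++ y :: U) = size D, pk (D ++ y :: U) = 0 & tie (D ++ y :: U) = 0].
Proof.
move=> Dy /increasing_stats[d0 p0 t0].
elim: D Dy => [//|x [|x' D] IH] /=.
  rewrite des_cons tie_cons d0 t0 => lt_yx; split; try lia.
  by case: U p0 {d0 t0 IH} => [|u U] p0 //; rewrite pk_cons p0; lia.
move=> /= /andP[lt_x' /IH /= [IHd IHp IHt]].
rewrite des_cons tie_cons IHd IHt; split; try lia.
by case: D IHp {IH IHd IHt} => [|x'' D] /= IHp; rewrite pk_cons IHp; lia.
Qed.

(** Without ties every step is an ascent or a descent, and without peaks no descent follows an
    ascent. *)
Lemma valleyP x s : pk (x :: s) = 0 -> tie (x :: s) = 0 ->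
  exists D y U,
    [/\ x :: s = D ++ y :: U, sorted gtn (rcons D y) & path ltn y U].
Proof.
elim: s x => [|x' s IH] x; first by move=> _ _; exists [::], x, [::].
move=> pk0; rewrite tie_cons => /eqP; rewrite addn_eq0 eqb0 => /andP[ne_xx' /eqP t0].
have p0 : pk (x' :: s) = 0 by case: s pk0 {IH t0} => // z s; rewrite pk_cons; lia.
have [[|d D] [y [U [defs Dy yU]]]] := IH x' p0 t0.
  case: defs => ? ?; subst x' s.
  have [lt_xy|le_yx] := ltnP x y; first by exists [::], x, (y :: U); rewrite /= lt_xy.
  by exists [:: x], y, U; split => //=; rewrite andbT; lia.
have defx' : x' = d by case: defs.
exists (x :: d :: D), y, U; split; rewrite ?defs //=.
(* Otherwise [x < d], and [d], followed by a smaller letter, would be a peak. *)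
have [//|le_xd] := ltnP d x; exfalso.
move: pk0 Dy; rewrite defx' in ne_xx' defs *; case: s defs {IH t0 p0} => [[]|z s].
  by case: (D).
case=> defs p0; case: D defs => [|d' D] /= -[? _]; subst z;
  by move: p0; rewrite pk_cons; lia.
Qed.

(** * Parking by counting letters, and the bijection with pairs *)

Lemma parkingE s : parking s = all (fun k => k <= count (geq k) s) (iota 1 (size s)).
Proof.
rewrite /parking (iotaDl 1 0) all_map; apply: eq_in_all => i.
rewrite mem_iota add0n => /= lt_i; rewrite add1n.
have ss := sort_sorted leq_total s.
have -> : count (geq i.+1) s = count (geq i.+1) (sort leq s).
  by apply/permP; rewrite perm_sym perm_sort.
have sz : size (sort leq s) = size s by rewrite size_sort.
(* The letters at most [i.+1] form a prefix of the sorted word; position [i] lies in it exactly when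
   its length exceeds [i]. *)
apply/idP/idP => [le_i|]; last exact: (@Order.POrderTheory.nth_count_le _ _ i.+1).
rewrite ltnNge; apply/negP => ge_i; move: le_i; rewrite leqNgt => /negP[].
by apply: (@Order.TotalTheory.DualTotalTheory.nth_count_gt _ _ i.+1) => //;
  rewrite ge_i sz; lia.
Qed.

(* U is stored decreasingly, as D, so that both grow at the head. *)
Definition valley_word (x : seq nat * seq nat) := x.1 ++ 1 :: rev x.2.

(** On plain sequences the range of the letters, enforced by ['I_n] in [PF], has to be spelled
    out. *)
Definition valley_parking n (s : seq nat) :=
  [&& size s == n, all (fun k => 0 < k <= n) s, parking s, pk s == 0 & tie s == 0].

(** Ending the decreasing sequence with 1 encodes that its letters exceed 1, which is the form
    [valley_stats] takes. *)
Lemma decrE m s : decr m s = all (geq m.+1) s && sorted gtn (rcons s 1).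
Proof.
have -> : decr m s = path gtn m.+2 (rcons s 1).
  rewrite /decr; have: 1 < m.+2 by [].
  elim: s m.+2 => [|x s IH] k /=; first by rewrite andbT.
  move=> lt1k; case: (ltnP x k) => //= lt_xk; case: (ltnP 1 x) => [/IH<-//|le_x1].
  rewrite andbF; apply/esym/negbTE/negP.
  move/(order_path_min (rev_trans ltn_trans))/allP/(_ 1).
  by rewrite mem_rcons mem_head ltnNge le_x1 => /(_ isT).
by rewrite (path_sortedE (rev_trans ltn_trans)) all_rcons.
Qed.

Lemma decr_path1 m s : decr m s = all (geq m.+1) s && path ltn 1 (rev s).
Proof. by rewrite decrE -rev_sorted rev_rcons. Qed.

(** The bottom letter 1 settles the first parking inequality and adds one to the count in all the
    others. *)
Lemma parking_valley_word m D U : size D + size U = m ->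
  parking (valley_word (D, U)) = balanced m (D, U).
Proof.
move=> sz; rewrite parkingE /valley_word /= size_cat /= size_rev addnS sz /=.
rewrite count_cat /= addnCA /= (iotaDl 1 1) all_map; apply: eq_all => k.
by rewrite /= add1n count_cat /= count_rev; lia.
Qed.

Lemma mem_valley_words m s :
  (s \in [seq valley_word x | x <- pairs m & size x.1 + size x.2 == m])
  = valley_parking m.+1 s.
Proof.
apply/mapP/and5P => [[[D U]]|].
  rewrite mem_filter /= mem_pairs /= => /andP[/eqP sz /and3P[Dm Um bal]] ->.
  move: (Dm) (Um); rewrite decrE decr_path1 => /andP[leD sD] /andP[leU sU].
  have [_ pk0 tie0] := valley_stats sD sU.
  split; rewrite /valley_word ?pk0 ?tie0 //=.
  - by rewrite size_cat /= size_rev; lia.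
  - rewrite all_cat /= all_rev; apply/andP; split.
      case/andP: Dm => _ gtD; apply/allP => x xD;
      by have := allP leD x xD; have := allP gtD x xD => /=; lia.
    case/andP: Um => _ gtU; apply/allP => x xU;
    by have := allP leU x xU; have := allP gtU x xU => /=; lia.
  - by rewrite (parking_valley_word sz).
case=> /eqP sz le_s prk /eqP pk0 /eqP t0.
case: s sz le_s prk pk0 t0 => [//|x s] sz le_s prk pk0 t0.
have [D [y [U [defs sD sU]]]] := valleyP pk0 t0.
(* Parking forces a letter at most 1, and [y] is the least letter of the valley. *)
have y1 : y = 1.
  have: 1 <= count (geq 1) (x :: s).
    by have := prk; rewrite parkingE sz => /andP[].
  rewrite -has_count => /hasP[z zs /= le_z1].
  have: y <= z.
    move: zs; rewrite defs mem_cat => /orP[zD|].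
      move: sD; rewrite -rev_sorted rev_rcons /=.
      by move/(order_path_min ltn_trans)/allP/(_ z); rewrite mem_rev => /(_ zD)/ltnW.
    rewrite inE => /predU1P[-> //|zU].
    exact/ltnW/(allP (order_path_min ltn_trans sU)).
  have: 0 < y <= m.+1 by apply: (allP le_s); rewrite defs mem_cat mem_head orbT.
  lia.
subst y; exists (D, rev U); last by rewrite /valley_word /= revK.
have szDU : size D + size (rev U) = m.
  by have := sz; rewrite defs size_cat /= size_rev; lia.
move: le_s; rewrite defs all_cat /= => /andP[/allP leD /allP leU].
rewrite mem_filter szDU eqxx mem_pairs /= -(parking_valley_word szDU) /valley_word /=.
rewrite revK -defs prk.
rewrite decrE decr_path1 revK sD sU !andbT; apply/andP; split.
  by apply/allP => z /leD /andP[].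
by apply/allP => z; rewrite mem_rev => /leU /andP[].
Qed.

(** All letters of [D] exceed 1, so the first 1 in the word marks where [D] ends. *)
Lemma valley_word_inj m : {in pairs m &, injective valley_word}.
Proof.
move=> [D U] [D' U']; rewrite !mem_pairs /=.
case/and3P=> /andP[_ gtD] _ _ /and3P[/andP[_ gtD'] _ _] eq_word.
have index1 V W : all (ltn 1) V -> index 1 (valley_word (V, W)) = size V.
  move=> /allP gtV; rewrite /valley_word /= index_cat.
  by case: ifP => [/gtV|] //=; rewrite addn0.
have sz : size D = size D' by rewrite -(index1 D U) // eq_word index1.
have /eqP := eq_word; rewrite /valley_word /= eqseq_cat // => /andP[/eqP-> /eqP[]].
by move/(can_inj revK)->.
Qed.

Lemma des_valley_word m x : x \in pairs m -> des (valley_word x) = size x.1.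
Proof.
case: x => D U; rewrite mem_pairs decrE decr_path1 /=.
by case/and3P=> /andP[_ sD] /andP[_ sU] _; case: (valley_stats sD sU).
Qed.

(** * Transfer to parking functions and Narayana numbers *)

Lemma word_inj n : injective (@word n).
Proof. by move=> v w /inj_map eq_vw; apply/val_inj/eq_vw => i j [/val_inj]. Qed.

Lemma mem_image_word m s :
  (s \in [seq word w | w in [pred w in PF m.+1 |
     (pk (word w) == 0) && (tie (word w) == 0)]])
  = valley_parking m.+1 s.
Proof.
apply/imageP/and5P => [[w] | [/eqP sz le_s prk pk0 tie0]].
  rewrite inE /= inE => /and3P[prk pk0 tie0] ->.
  split=> //; first by rewrite size_map size_tuple.
  by apply/allP => _ /mapP[i _ ->] /=; exact: ltn_ord.
have szw : size [seq (inord x.-1 : 'I_m.+1) | x <- s] == m.+1 by rewrite size_map sz.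
have defs : s = word (Tuple szw).
  rewrite /word /= -map_comp -[LHS]map_id; apply/eq_in_map => x /(allP le_s) /= le_x.
  by rewrite inordK; lia.
by exists (Tuple szw); rewrite // inE /= inE -defs prk pk0.
Qed.

Lemma sum_PF m (V : nmodType) (F : seq nat -> V) : (
  \sum_(w in PF m.+1 | (pk (word w) == 0%N) && (tie (word w) == 0%N)) F (word w)
  = \sum_(x <- pairs m | (size x.1 + size x.2 == m)%N) F (valley_word x))%R.
Proof.
rewrite -[RHS]big_filter -[RHS](big_map valley_word predT).
transitivity (\sum_(s <- [seq word w | w in [pred w in PF m.+1 |
    (pk (word w) == 0) && (tie (word w) == 0)]]) F s)%R.
  by rewrite big_image.
apply/perm_big/uniq_perm.
- by rewrite map_inj_uniq ?enum_uniq //; apply: word_inj.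
- rewrite map_inj_in_uniq ?filter_uniq ?uniq_pairs // => x y.
  by rewrite !mem_filter => /andP[_ xm] /andP[_ ym]; apply: valley_word_inj ym.
by move=> s; rewrite mem_image_word mem_valley_words.
Qed.

(** By symmetry of binomials the determinant becomes C(m,j)^2 - C(m,j-1) C(m,j+1); the factor [m.+1]
    avoids division. *)
Lemma narayana m j : j <= m ->
  m.+1 * npairs m j (m - j) = 'C(m.+1, j) * 'C(m.+1, j.+1).
Proof.
move=> le_jm; have := @npairsE m j (m - j) ltac:(lia).
rewrite bin_sub //; case: j le_jm => [|j] le_jm.
  rewrite subn0 (@bin_small m m.+1) // !bin0 !bin1 muln0 addn0 => ->; lia.
rewrite subnSK // bin_sub 1?ltnW // !binS.
have := mul_bin_left m j.+1; have := mul_bin_left m j.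
have -> : m - j = (m - j.+1).+1 by lia.
have defm : m = j.+1 + (m - j.+1) by lia.
move: defm; move: (m - j.+1) => d defm.
move: (npairs _ _ _) 'C(m, j) 'C(m, j.+1) 'C(m, j.+2) => N p q r E1 E2 E3.
(* [E1] and [E2] are the ratios of consecutive binomials; these multiples make the goal linear in
   the products of [p], [q], [r]. *)
rewrite defm; have := congr1 (muln q) E2; have := congr1 (muln q) E1.
have := congr1 (muln p) E2; have := congr1 (muln r) E1.
have := congr1 (muln (j + d).+2) E3; lia.
Qed.

Local Open Scope ring_scope.

Theorem theorem6p1 (n : nat) (hn : (1 <= n)%N) :
  \sum_(w in PF n | (pk (word w) == 0%N) && (tie (word w) == 0%N))
     'X^(des (word w)) =
  \sum_(0 <= j < n)
     ((n%:R^-1 * 'C(n, j)%:R * 'C(n, j.+1)%:R) *: 'X^j) :> {poly rat}.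
Proof.
case: n hn => // m _.
rewrite (@sum_PF m _ (fun s => 'X^(des s))).
apply/polyP => i; rewrite !coef_sum.
rewrite (eq_bigr (fun j => if j == i then
    m.+1%:R^-1 * 'C(m.+1, j)%:R * 'C(m.+1, j.+1)%:R else 0)); last first.
  by move=> j _; rewrite coefZ coefXn eq_sym; case: eqP; rewrite ?mulr1 ?mulr0.
rewrite -big_mkcond /= big_nat1_eq /=.
rewrite big_seq_cond (eq_bigr (fun x => (size x.1 == i)%:R)); last first.
  by move=> x /andP[xm _]; rewrite (des_valley_word xm) coefXn eq_sym.
rewrite -big_seq_cond big_mkcond /=; case: ltnP => [le_im|lt_mi]; last first.
  rewrite big1 // => x _; case: eqP => // sz.
  by case: eqP => // szi; exfalso; lia.
(* As the sizes sum to [m], fixing [size x.1 = i] fixes the other, so the coefficient is a single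
   [npairs]. *)
transitivity ((npairs m i (m - i)%N)%:R : rat).
  rewrite /npairs -sum1_count natr_sum [RHS]big_mkcond /=.
  apply: eq_bigr => x _; case: eqP => sz; case: eqP => sz1;
    case: eqP => sz2 //=; exfalso; lia.
by rewrite -mulrA -natrM -narayana // natrM mulKf // Num.Theory.pnatr_eq0.
Qed.
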